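(* Let $N\in\mathbb{N}$ and let $S\subseteq[1,N]$ with $s=|S|\ge\frac{N+1}{2}$ and $r(S)=f_{s,N}$, where $f_{s,N}$ is the smallest value of $r$ over all subsets of $[1,N]$ of size $s$. Then: - if $s>\frac{N+1}{2}$ or $N$ is even, then $S=[N-s+1,N]$; - if $N$ is odd and $s=\frac{N+1}{2}$, then $S=[N-s+1,N]$ or $S=\{1,3,5,\ldots,2(N-s)+1\}$.
   Context: $\mathbb{N}$ denotes the positive integers. For integers $a\le b$, $[a,b]$ denotes the set of integers $x$ with $a\le x\le b$. For a finite set $S\subseteq\mathbb{N}$, $r(S)=|\{(x,y)\in S^2: x+y\in S\}|$ (ordered pairs, $x=y$ allowed). *)

(* Defs.v *)
From mathcomp Require Import all_boot.
From mathcomp Require Import finmap.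

Set Implicit Arguments.
Unset Strict Implicit.
Unset Printing Implicit Defensive.

Local Open Scope fset_scope.
Local Open Scope nat_scope.

Definition interval (a b : nat) : {fset nat} := [fset x in index_iota a b.+1].

Lemma in_interval (a b x : nat) : (x \in interval a b) = (a <= x <= b).
Proof. by rewrite !inE mem_index_iota ltnS. Qed.

Definition r (S : {fset nat}) : nat :=
  #|` [fset p in S `*` S | p.1 + p.2 \in S] |.

Lemma r_le_sq (S : {fset nat}) : r S <= #|` S| ^ 2.
Proof.
rewrite -mulnn -(size_allpairs pair S S); apply: uniq_leq_size => //= -[x y].
by rewrite !inE /= => /andP[/andP[xS yS] _]; apply/allpairsP; exists (x, y).
Qed.

(* The neutral element s ^ 2 bounds r on all sets of size s (r_le_sq), so for
   s <= N this is the true minimum; see f_attained and f_le. *)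
Definition f (s N : nat) : nat :=
  \big[minn/s ^ 2]_(A <- fpowerset (interval 1 N) | #|` A| == s) r A.

Lemma f_le (s N : nat) (A : {fset nat}) :
  A `<=` interval 1 N -> #|` A| = s -> f s N <= r A.
Proof.
rewrite -fpowersetE /f => AN /eqP As.
elim: (enum_fset _) (AN : A \in enum_fset _) => // B l IH.
rewrite inE big_cons => /predU1P[<-|/IH le_r]; first by rewrite As geq_minl.
by case: ifP => // _; rewrite geq_min le_r orbT.
Qed.

Lemma f_attained (s N : nat) : s <= N ->
  exists A : {fset nat},
    [/\ A `<=` interval 1 N, #|` A| = s & f s N = r A].
Proof.
move=> sN; pose Q m := exists A : {fset nat},
  [/\ A `<=` interval 1 N, #|` A| = s & m = r A].
have [//|f_max] : Q (f s N) \/ f s N = s ^ 2.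
  rewrite /f big_seq_cond.
  elim/big_rec: _ => [|A m /andP[AN /eqP As] IH]; first by right.
  rewrite /minn; case: ifP => // _; left; exists A; split=> //.
  by rewrite -fpowersetE.
have card_s : #|` interval 1 s| = s.
  by rewrite card_fseq undup_id ?iota_uniq // size_iota subn1.
have sub_s : interval 1 s `<=` interval 1 N.
  apply/fsubsetP => x; rewrite !in_interval => /andP[-> xs].
  exact: leq_trans sN.
exists (interval 1 s); split=> //.
by apply/eqP; rewrite eqn_leq f_le //= f_max -{2}card_s r_le_sq.
Qed.

(* Main.v *)
(** The number of [x] in [[1, z - 1]] with [x] and [z - x] both in [S] is at
    least [2 c - (z - 1)], where [c] is the number of elements of [S] below [z];
    since at most [N - z] elements of [S] exceed [z], this is at least [c - d]
    with [d = N - s].  As [z] runs through [S], [c] runs through [0 .. s - 1], so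
    [r S >= \sum_(i < s) (i - d)] (truncated subtraction), with equality for
    [S = [d + 1, N]].  In the equality case [S] contains [[2 d + 2, N]], and its
    other [d + 1] elements form a sum-free subset of [[1, 2 d + 1]].  Such a set
    contains [2 d + 1], hence exactly one of [x] and [2 d + 1 - x] for all
    [1 <= x <= 2 d].  If it contains [1] it must alternate; otherwise it contains
    [2 d], which makes it closed under successor below [2 d]. *)

Require Import Defs.
From mathcomp Require Import all_boot finmap zify.

Set Implicit Arguments.
Unset Strict Implicit.
Unset Printing Implicit Defensive.

Local Open Scope fset_scope.
Local Open Scope nat_scope.

(** * Counting elements and representations below a point *)

Definition below (P : pred nat) (z : nat) : nat := count P (index_iota 1 z).

Definition reps (P : pred nat) (z : nat) : nat :=
  count (fun x => P x && P (z - x)) (index_iota 1 z).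

Lemma belowS (P : pred nat) (z : nat) :
  ~~ P 0 -> below P z.+1 = below P z + P z.
Proof.
case: z => [/negPf P0 | z _]; first by rewrite P0.
by rewrite /below /index_iota !subSS !subn0 -{1}(addn1 z) iotaD count_cat /= addn0 add1n.
Qed.

Lemma leq_below (P : pred nat) (m n : nat) :
  ~~ P 0 -> m <= n -> below P n <= below P m + (n - m).
Proof.
move=> P0; elim: n => [|n IH]; first by rewrite leqn0 => /eqP ->; lia.
rewrite leq_eqVlt => /orP[/eqP <- | mn]; first by lia.
by rewrite belowS //; have := IH mn; case: (P n); lia.
Qed.

Lemma below_homo (P : pred nat) (m n : nat) :
  ~~ P 0 -> m <= n -> below P m <= below P n.
Proof.
move=> P0 /subnKC <-; elim: (n - m) => [|k IH]; first by rewrite addn0.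
by rewrite addnS belowS //; lia.
Qed.

(** In increasing order, the element with index [i] has exactly [i] elements below it. *)
Lemma sum_below (P : pred nat) (g : nat -> nat) (n : nat) : ~~ P 0 ->
  \sum_(0 <= z < n | P z) g (below P z) = \sum_(0 <= i < below P n) g i.
Proof.
move=> P0; elim: n => [|n IH]; first by rewrite !big_geq.
rewrite big_mkcond big_nat_recr //= -big_mkcond /= IH belowS //.
by case: (P n); rewrite ?addn0 // addn1 big_nat_recr.
Qed.

Lemma count_rev (P : pred nat) (z : nat) :
  count (fun x => P (z - x)) (index_iota 1 z) = below P z.
Proof. by rewrite /below -!sum1_count [RHS]big_nat_rev. Qed.

(** Inclusion-exclusion for [P] and its reflection under [x -> z - x], which have equally many
    elements in [[1, z - 1]]. *)
Lemma count_or_reps (P : pred nat) (z : nat) :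
  count (fun x => P x || P (z - x)) (index_iota 1 z) + reps P z = 2 * below P z.
Proof.
by rewrite (count_predUI P (fun x => P (z - x))) count_rev -/(below P z); lia.
Qed.

Lemma reps_ge (P : pred nat) (z : nat) : 2 * below P z <= reps P z + z.-1.
Proof.
rewrite -count_or_reps addnC leq_add2l (leq_trans (count_size _ _)) //.
by rewrite size_iota subn1.
Qed.

Lemma repsP (P : pred nat) (x y : nat) :
  ~~ P 0 -> P x -> P y -> 0 < reps P (x + y).
Proof.
move=> P0 Px Py; rewrite /reps -has_count; apply/hasP; exists x.
  have x0 : x != 0 by apply: contraNneq P0 => <-.
  have y0 : y != 0 by apply: contraNneq P0 => <-.
  by rewrite mem_index_iota; lia.
by rewrite Px addKn.
Qed.

Lemma reps_gt1 (P : pred nat) (x y : nat) :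
  ~~ P 0 -> P x -> P y -> x != y -> 1 < reps P (x + y).
Proof.
move=> P0 Px Py xy.
have x0 : x != 0 by apply: contraNneq P0 => <-.
have y0 : y != 0 by apply: contraNneq P0 => <-.
have uxy : uniq [:: x; y] by rewrite /= inE xy.
rewrite /reps -size_filter; apply: (uniq_leq_size uxy) => z.
rewrite !inE mem_filter mem_index_iota => /orP[] /eqP ->.
  by rewrite Px addKn Py; lia.
by rewrite Py addnK Px; lia.
Qed.

Lemma count_range (a b n : nat) :
  0 < a -> count (fun x => a <= x < b) (index_iota 1 n) = minn b n - a.
Proof.
move=> a0; rewrite -/(below _ n); elim: n => [|n IH]; first by rewrite /below /=; lia.
by rewrite belowS ?IH; case: (boolP (a <= n < b)) => /=; lia.
Qed.

(** * The minimum of [r] and its equality case *)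

Lemma r_sum_reps (N : nat) (S : {fset nat}) : S `<=` interval 1 N ->
  r S = \sum_(0 <= z < N.+1 | z \in S) reps (mem S) z.
Proof.
move=> /fsubsetP SN.
pose t z := [seq x <- index_iota 1 z | (x \in S) && (z - x \in S)].
pose L := [seq (x, z - x) | z <- [seq z <- index_iota 0 N.+1 | z \in S], x <- t z].
have uL : uniq L.
  apply: allpairs_uniq_dep => [|z _|]; rewrite ?filter_uniq ?iota_uniq //.
  move=> _ _ /allpairsPdep[z [x [_ xz ->]]] /allpairsPdep[w [y [_ yw ->]]] /= [xy zw].
  move: xz yw; rewrite !mem_filter !mem_index_iota => /andP[_ xz] /andP[_ yw].
  have -> : z = w by lia.
  by rewrite xy.
have memL : [fset p in S `*` S | p.1 + p.2 \in S] =i L.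
  move=> [x y]; rewrite !inE /=; apply/idP/allpairsPdep.
    move=> /andP[/andP[xS yS] xyS]; exists (x + y), x.
    have := SN _ xS; have := SN _ yS; have := SN _ xyS.
    rewrite !in_interval !mem_filter !mem_index_iota xyS xS addKn yS /= => *.
    by split=> //; lia.
  move=> [z [w []]]; rewrite !mem_filter !mem_index_iota.
  move=> /andP[zS _] /andP[/andP[wS zwS] wz] [-> ->].
  by rewrite wS zwS subnKC //; lia.
rewrite /r (perm_size (uniq_perm (fset_uniq _) uL memL)) size_allpairs_dep.
rewrite sumnE big_map big_filter; apply: eq_bigr => z _.
by rewrite size_filter.
Qed.

Lemma sum_eq_pointwise (P : pred nat) (F G : nat -> nat) (n : nat) :
  (forall i, P i -> F i <= G i) ->
  \sum_(0 <= i < n | P i) G i <= \sum_(0 <= i < n | P i) F i ->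
  forall i, i < n -> P i -> F i = G i.
Proof.
move=> FG; elim: n => // n IH; rewrite ![\sum_(_ <= _ < _.+1 | _) _]big_mkcond.
rewrite !big_nat_recr //= -!big_mkcond /= => le i.
have le_sum : \sum_(0 <= i < n | P i) F i <= \sum_(0 <= i < n | P i) G i.
  exact: leq_sum.
rewrite ltnS leq_eqVlt => /orP[/eqP -> Pn | ltin Pi].
  by move: le (FG _ Pn); rewrite Pn; lia.
by apply: IH => //; move: le (FG n); case: (P n) => [le /(_ isT)|]; lia.
Qed.

Lemma card_below (N : nat) (S : {fset nat}) : S `<=` interval 1 N ->
  below (mem S) N.+1 = #|` S|.
Proof.
move=> /fsubsetP SN; rewrite /below -size_filter; apply: perm_size.
apply: uniq_perm; rewrite ?filter_uniq ?iota_uniq ?fset_uniq // => x.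
rewrite mem_filter mem_index_iota ltnS -in_interval /=.
by apply: andb_idr => /SN.
Qed.

Lemma notin0_sub (N : nat) (S : {fset nat}) : S `<=` interval 1 N -> 0 \notin S.
Proof. by move=> /fsubsetP SN; apply/negP => /SN; rewrite in_interval. Qed.

(** For [z] in the interval, [x] and [z - x] both lie in it only if [d < x < z - d], which leaves at
    most [z - (2 * d + 1)] choices. *)
Lemma r_top_interval (d s : nat) :
  r (interval d.+1 (d + s)) <= \sum_(0 <= i < s) (i - d).
Proof.
set U := interval _ _.
have UN : U `<=` interval 1 (d + s).
  by apply/fsubsetP => x; rewrite !in_interval; lia.
have U0 := notin0_sub UN.
have belowU z : z <= (d + s).+1 -> below (mem U) z = z - d.+1.
  move=> zN; rewrite /below (eq_count (a2 := fun x => d.+1 <= x < (d + s).+1)).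
    by rewrite count_range //; lia.
  by move=> x /=; rewrite in_interval.
have -> : \sum_(0 <= i < s) (i - d) =
          \sum_(0 <= z < (d + s).+1 | z \in U) (below (mem U) z - d).
  by rewrite (sum_below (P := mem U) (fun i => i - d)) // belowU // subSS addKn.
rewrite (r_sum_reps UN) big_seq_cond [leqRHS]big_seq_cond; apply: leq_sum => z.
rewrite mem_index_iota => /andP[zN zU]; rewrite belowU; last by lia.
rewrite (leq_trans (sub_count (a2 := fun x => d.+1 <= x < z - d) _ _)) //.
  by move=> x /=; rewrite !in_interval; lia.
by rewrite count_range //; lia.
Qed.

(** Each term is bounded below by the truncated difference, and comparison with the top interval
    bounds the sum from above by the same quantities, so every bound is tight. *)
Lemma minimal_reps (N s : nat) (S : {fset nat}) :
  S `<=` interval 1 N -> #|` S| = s -> s <= N -> r S <= f s N ->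
  {in S, forall z, reps (mem S) z = below (mem S) z - (N - s)}.
Proof.
move=> SN cS sN rS z zS; have S0 := notin0_sub SN.
have zN : z <= N by move/fsubsetP: SN => /(_ _ zS); rewrite in_interval => /andP[].
apply/esym; apply: (@sum_eq_pointwise (mem S) (fun z => below (mem S) z - (N - s))
  (reps (mem S)) N.+1) => // [x xS|].
  have {}xS : x \in S by [].
  have xN : 0 < x <= N by move/fsubsetP: SN => /(_ _ xS); rewrite in_interval.
  have := reps_ge (mem S) x.
  have := @leq_below (mem S) x.+1 N.+1 S0.
  rewrite (belowS x) // (card_below SN) cS /= xS; lia.
rewrite -(r_sum_reps SN) (sum_below (P := mem S) (fun i => i - (N - s))) //.
rewrite (card_below SN) cS (leq_trans rS) // -{1}(subnK sN).
apply: leq_trans (r_top_interval _ _); apply: f_le.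
  by apply/fsubsetP => x; rewrite !in_interval; lia.
rewrite card_fseq undup_id ?iota_uniq // size_iota; lia.
Qed.

(** * Sum-free sets of [d + 1] elements in [[1, 2 d + 1]] *)

Section MaximalSumFree.

Variables (P : pred nat) (d : nat).
Hypothesis P0 : ~~ P 0.
Hypothesis cardP : below P (2 * d + 2) = d.+1.
Hypothesis sum_free : forall z, P z -> z <= 2 * d + 1 -> reps P z = 0.

(** By [reps_ge], an element [n <= 2 * d] has fewer than [d] elements below it, so the largest of
    the [d + 1] elements can only be [2 * d + 1]. *)
Lemma sum_free_max : P (2 * d + 1) /\ below P (2 * d + 1) = d.
Proof.
have le_d n : n <= 2 * d + 1 -> below P n <= d.
  elim: n => // n IH n_le; rewrite belowS //.
  case: (boolP (P n)) => [Pn|_]; last by rewrite addn0 IH // ltnW.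
  have := reps_ge P n; rewrite sum_free //; last by lia.
  have : n != 0 by apply: contraNneq P0 => <-.
  lia.
have := le_d _ (leqnn _); move: cardP.
rewrite [2 * d + 2]addnS belowS // => cP le.
by case: (P (2 * d + 1)) cP; lia.
Qed.

Lemma sum_freeN (x y : nat) : P x -> P y -> x + y <= 2 * d + 1 -> ~~ P (x + y).
Proof.
by move=> Px Py le; apply/negP => /sum_free/(_ le) E; move: (repsP P0 Px Py); rewrite E.
Qed.

(** Inclusion-exclusion at [2 * d + 1] shows that [P] and its reflection cover [[1, 2 d]]; they are
    disjoint because [2 * d + 1] is not a sum. *)
Lemma sum_free_compl (x : nat) : 0 < x <= 2 * d -> P (2 * d + 1 - x) = ~~ P x.
Proof.
move=> x_le; have [Pm cm] := sum_free_max.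
have Pxy : P x || P (2 * d + 1 - x).
  have := count_or_reps P (2 * d + 1); rewrite sum_free // addn0 cm => cE.
  have /allP : all (fun y => P y || P (2 * d + 1 - y)) (index_iota 1 (2 * d + 1)).
    by rewrite all_count cE size_iota addnK.
  by apply; rewrite mem_index_iota; lia.
have := @sum_freeN x (2 * d + 1 - x); rewrite subnKC ?Pm; last by lia.
by move: Pxy; case: (P x); case: (P _) => //= _ /(_ isT isT (leqnn _)).
Qed.

Lemma sum_free_odd : P 1 -> forall x, x <= 2 * d + 1 -> P x = odd x.
Proof.
move=> P1; elim=> [_|x IH x_le]; first exact: (negPf P0).
have -> : odd x.+1 = ~~ P x by rewrite IH // ltnW.
have [-> | x0] := posnP x; first by rewrite P1 (negPf P0).
case: (boolP (P x)) => Px /=; first by have := sum_freeN Px P1; rewrite addn1 => /(_ x_le)/negPf.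
have [x_eq|x_lt] : x.+1 = 2 * d + 1 \/ x.+1 <= 2 * d by lia.
  by rewrite x_eq; case: sum_free_max.
(* If [x] and [x.+1] both failed [P], their reflections would be consecutive elements of [P], which
   [P 1] forbids. *)
apply/negPn; rewrite -sum_free_compl //.
have Py : P (2 * d + 1 - x) by rewrite sum_free_compl //; lia.
apply/negP => Py'; have := sum_freeN P1 Py'.
have -> : 1 + (2 * d + 1 - x.+1) = 2 * d + 1 - x by lia.
by rewrite Py => /(_ ltac:(lia)).
Qed.

Lemma sum_free_top : ~~ P 1 -> forall x, x <= 2 * d + 1 -> P x = (d < x).
Proof.
move=> P1; have [Pm _] := sum_free_max.
have d0 : 0 < d by case: (posnP d) Pm P1 => // -> ->.
have P2d : P (2 * d) by have := @sum_free_compl 1; rewrite P1 addnK => ->; lia.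
(* As [2 * d] is not a sum, [2 * d - x] fails [P]; its reflection is [x.+1]. *)
have succ x : P x -> x <= 2 * d -> P x.+1.
  move=> Px; rewrite leq_eqVlt => /orP[/eqP -> | x_lt]; first by rewrite -addn1.
  have := @sum_freeN x (2 * d - x) Px; rewrite subnKC ?P2d; last by lia.
  have := @sum_free_compl (x.+1); have -> : 2 * d + 1 - x.+1 = 2 * d - x by lia.
  by move=> ->; [case: (P x.+1) => //= /(_ isT); lia | lia].
have low x : x <= d -> ~~ P x.
  move=> xd; apply/negP => Px.
  (* Climbing by successors from [x <= d] reaches [x + x], a forbidden sum. *)
  have up k : x + k <= 2 * d -> P (x + k).
    by elim: k => [|k IH le]; rewrite ?addn0 // addnS succ ?IH //; lia.
  by have := sum_freeN Px Px; rewrite up => [/(_ ltac:(lia))|]; last by lia.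
move=> x x_le; case: (leqP x d) => [/low/negPf // | dx].
have [->//|x_lt] : x = 2 * d + 1 \/ x <= 2 * d by lia.
by rewrite -[LHS]negbK -sum_free_compl ?low //; lia.
Qed.

End MaximalSumFree.

Theorem theorem3p4 (N s : nat) (S : {fset nat})
    (hN : 0 < N) (hS : S `<=` interval 1 N) (hs : #|` S| = s)
    (hsN : N + 1 <= 2 * s) (hr : r S = f s N) :
  (N + 1 < 2 * s \/ ~~ odd N -> S = interval (N - s + 1) N) /\
  (odd N -> 2 * s = N + 1 ->
     S = interval (N - s + 1) N \/
     S = [fset x in interval 1 (2 * (N - s) + 1) | odd x]).
Proof.
have S0 := notin0_sub hS; have cN := card_below hS; rewrite hs in cN.
have sN : s <= N by have := @leq_below (mem S) 1 N.+1 S0; rewrite cN /below /=; lia.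
have S_le x : x \in S -> 0 < x <= N.
  by move/fsubsetP: hS => /[apply]; rewrite in_interval.
have Sreps := minimal_reps hS hs sN (eq_leq hr).
pose d := N - s; rewrite -/d in Sreps *.
(* An element [n <= 2 * d + 1] with [c] elements below it satisfies [2 c <= (c - d) + (n - 1)],
   hence [c <= d]. *)
have c_le n : n <= 2 * d + 2 -> below (mem S) n <= d.+1.
  elim: n => // n IH n_le; rewrite belowS //=.
  case: (boolP (n \in S)) => [nS|_]; last by rewrite addn0 IH // ltnW.
  have := reps_ge (mem S) n; rewrite Sreps //; have := S_le _ nS; have := IH (ltnW n_le).
  by rewrite addn1; move: (below _ _) => c; lia.
(* By [hsN], [2 * d + 1 <= N]; at most [N - (2 * d + 1)] of the [s] elements lie above [2 * d + 1],
   so at least [d + 1] remain. *)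
have cS : below (mem S) (2 * d + 2) = d.+1.
  have := c_le _ (leqnn _); have := @leq_below (mem S) (2 * d + 2) N.+1 S0.
  by rewrite cN; lia.
have free z : z \in S -> z <= 2 * d + 1 -> reps (mem S) z = 0.
  move=> zS z_le; rewrite Sreps //.
  have := @below_homo (mem S) z.+1 (2 * d + 2) S0; rewrite belowS //= zS cS.
  lia.
have high x : 2 * d + 2 <= x <= N -> x \in S.
  move=> /andP[x_ge x_le]; apply/negPn/negP => /negPf xS.
  have := @leq_below (mem S) (2 * d + 2) x S0 x_ge.
  have := @leq_below (mem S) x.+1 N.+1 S0 x_le.
  rewrite cN cS belowS //= xS; lia.
have top : (forall x, x <= 2 * d + 1 -> (x \in S) = (d < x)) ->
    S = interval (d + 1) N.
  move=> E; apply/fsetP => x; rewrite in_interval.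
  case: (leqP x (2 * d + 1)) => [x_le | x_gt]; first by rewrite E //; lia.
  case: (leqP x N) => xN; first by rewrite high; lia.
  by apply/idP/idP => [/S_le|]; lia.
case: (boolP (1 \in S)) => S1; last first.
  by have E := top (@sum_free_top (mem S) d S0 cS free S1); split=> // *; left.
have Sodd := @sum_free_odd (mem S) d S0 cS free S1.
split=> [strict | oddN sE].
  apply: top => x x_le; transitivity (odd x); first exact: Sodd.
  (* For [d = 0] the two patterns agree on [[0, 1]]; otherwise [strict] gives [2 * d + 2 <= N]. *)
  have [d0|d_gt] := posnP d; first by case: x x_le => [|[|x]] //=; lia.
  have e2 : 2 * d + 2 \in S by apply: high; lia.
  have em : 2 * d + 1 \in S by apply: etrans (Sodd _ (leqnn _)) _; lia.
  (* [1] and [2 d + 1] give two representations of [2 d + 2], only one is allowed. *)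
  have := @reps_gt1 (mem S) 1 (2 * d + 1) S0 S1 em.
  rewrite addnCA addnn Sreps // cS; lia.
right; apply/fsetP => x; rewrite !inE mem_index_iota.
case: (leqP x (2 * d + 1)) => [x_le | x_gt].
  by apply: etrans (Sodd _ x_le) _; have := @odd_gt0 x; case: (odd x) => [/(_ isT)|_]; lia.
(* Here [N = 2 * d + 1], so [x] exceeds [N]. *)
by rewrite andbC; apply/idP/idP => [/S_le|]; lia.
Qed.
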